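(* Let $E$ be a Borel space and $Q$ a semi-Markov kernel on $\mathbb{R}_+\times E$ given $E$ satisfying: there exist $\delta>0$, $\epsilon>0$ with $Q(\delta,E\mid x)\le1-\epsilon$ for all $x\in E$. Let $c,g:E\to[0,\infty)$ be measurable and $T\in\mathbb{R}_+$. Then for every $\pi=\{d_n,n\ge0\}\in\Pi^0_{DH}$, $$U^\pi(s,x)=V^{\tau^s_\pi}(s,x)\qquad\text{for all }x\in E,\ s\in[0,T],$$ where $\tau^s_\pi$ is the stopping time induced by $\pi$ and $s$.
   Context: SMP: Semi-Markov kernel means: for each $B\in\mathcal{B}(E)$, $x$, $t\mapsto Q(t,B\mid x)$ nondecreasing, right-continuous, $Q(0,B\mid x)=0$; $Q(t,\cdot\mid\cdot)$ substochastic; $\lim_{t\to\infty}Q(t,\cdot\mid\cdot)$ stochastic. $\Omega=\{(x_0,t_1,x_1,\dots): x_0\in E,(t_n,x_n)\in\mathbb{R}_+\times E\}$; $X_n(\omega)=x_n$, $T_0=0$, $T_{n+1}(\omega)=t_{n+1}$, $S_n=\sum_{k=0}^nT_k$, $Y_n=(X_0,T_1,X_1,\dots,T_n,X_n)$, $\mathcal{F}_n=\sigma(T_0,X_0,\dots,T_n,X_n)$; $\mathbb{P}_x$ is the unique probability with $\mathbb{P}_x(T_0=0,X_0=x)=1$ and $\mathbb{P}_x(T_{n+1}\le t,X_{n+1}\in B\mid Y_n)=Q(t,B\mid X_n)$, $\mathbb{E}_x$ its expectation; $X(t)=X_n$ for $S_n\le t<S_{n+1}$. A stopping time is $\tau:\Omega\to\mathbb{N}\cup\{\infty\}$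 with $\{\tau=n\}\in\mathcal{F}_n$. $R^s_\tau=\int_0^{S_\tau}c(X(t))\,dt+g(X(S_\tau))$ if $S_\tau<s$, and $\int_0^sc(X(t))\,dt$ if $S_\tau\ge s$ ($S_\tau=\lim_nS_n$ on $\{\tau=\infty\}$); $V^\tau(s,x)=\mathbb{E}_x[R^s_\tau]$. Constructed SMDP: $\hat E=E\cup\{\Delta\}$, $A=\{0,1\}$, $A(x)=\{0,1\}$ for $x\in E$, $A(\Delta)=\{1\}$; $\hat Q_T(t,B\mid x,0)=Q(t,B\setminus\{\Delta\}\mid x)$ for $x\in E$, $\hat Q_T(t,B\mid x,1)=\mathbf{1}_{[T+1,\infty)}(t)\delta_\Delta(B)$ for $x\in\hat E$; $\hat c(x,a)=c(x)$ if $x\in E,a=0$, else $0$; $\hat g(x,a)=g(x)$ if $x\in E,a=1$, else $0$. $\hat H_n$: histories $\hat h_n=(x_0,a_0,t_1,x_1,\dots,a_{n-1},t_n,x_n)$ with $a_m\in A(x_m)$. A deterministic policy $\pi=\{d_n\}$ consists of measurable $d_n:\mathbb{R}\times\hat H_n\to A$ with $d_n(s,\hat h_n)\in A(x_n)$; on $\hat\Omega=(\hat E\times A\times\mathbb{R}_+)^\infty$ with coordinates $\hat X_n,A_n,\hat T_{n+1}$, $\hat T_0=0$, $\hat S_n=\sum_{m\le n}\hat T_m$, $\hat Y_n=(\hat X_0,A_0,\hat T_1,\dots,\hat T_n,\hat X_n)$, $\hat{\mathbb{P}}^\pi_{(s,x)}$ is the unique probability with $\hat X_0=x$, $\hat T_0=0$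 a.s., $A_n=d_n(s-\hat S_n,\hat Y_n)$ a.s., and $\hat{\mathbb{P}}^\pi_{(s,x)}(\hat T_{n+1}\le t,\hat X_{n+1}\in B\mid\hat Y_n,A_n)=\hat Q_T(t,B\mid\hat X_n,A_n)$; $\hat X(t)=\hat X_n$, $A(t)=A_n$ for $\hat S_n\le t<\hat S_{n+1}$; $U^\pi(s,x)=\hat{\mathbb{E}}^\pi_{(s,x)}\big[\int_0^s\hat c(\hat X(t),A(t))\,dt+\hat g(\hat X(s),A(s))\big]$. $H^0_n=E\times(\{0\}\times\mathbb{R}_+\times E)^n\subset\hat H_n$; $\Pi^0_{DH}$ is the set of deterministic policies with $d_n(0,\hat h_n)=0$ for all $n$ and $\hat h_n\in H^0_n$. With $Y^0_n=(X_0,0,T_1,X_1,\dots,0,T_n,X_n)$, the stopping time induced by $\pi$ and $s\in\mathbb{R}$ is $\tau^s_\pi(\omega)=\inf\{n\in\mathbb{N}:d_n(s-S_n(\omega),Y^0_n(\omega))=1\}$, $\inf\emptyset=+\infty$. *)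

(* Defs.v *)
From HB Require Import structures.
From mathcomp Require Import all_boot all_order all_algebra.
From mathcomp Require Import all_classical all_reals all_analysis.
Set Implicit Arguments. Unset Strict Implicit. Unset Printing Implicit Defensive.
Import Order.TTheory GRing.Theory Num.Theory.
Import numFieldNormedType.Exports.
Local Open Scope classical_set_scope.
Local Open Scope ring_scope.

Definition ehat (E : Type) : Type := option E.
Definition Delta {E : Type} : ehat E := None.

Definition ehat_display : measure_display -> measure_display.
Proof. exact. Qed.

Section ehat_measurable.
Context {d : measure_display} (E : measurableType d).

HB.instance Definition _ := Pointed.on (ehat E).

Definition ehat_measurable (B : set (ehat E)) : Prop :=
  measurable (@Some E @^-1` B).

Let ehat_m0 : ehat_measurable set0.
Proof. by rewrite /ehat_measurable preimage_set0; exact: measurable0. Qed.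

Let ehat_mC B : ehat_measurable B -> ehat_measurable (~` B).
Proof. by rewrite /ehat_measurable preimage_setC => mB; exact: measurableC. Qed.

Let ehat_mU (F : (set (ehat E))^nat) :
  (forall i, ehat_measurable (F i)) -> ehat_measurable (\bigcup_i F i).
Proof. by move=> mF; rewrite /ehat_measurable preimage_bigcup; exact: bigcupT_measurable. Qed.

HB.instance Definition _ := @isMeasurable.Build (ehat_display d) (ehat E)
  ehat_measurable ehat_m0 ehat_mC ehat_mU.
End ehat_measurable.

Section defs.
Context {R : realType} {dE : measure_display} {E : measurableType dE}.

Definition borel_space : Prop :=
  exists (A : set R) (f : E -> R) (g : R -> E),
    [/\ measurable A, measurable_fun setT f, measurable_fun A g,
        (forall x, A (f x) /\ g (f x) = x) & (forall y, A y -> f (g y) = y)].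

Definition semi_markov_kernel (Q : R -> set E -> E -> R) : Prop :=
  [/\
      (forall t B, 0 <= t -> measurable B -> measurable_fun setT (Q t B)),
      (forall B x, measurable B ->
         [/\ (forall u v, 0 <= u -> u <= v -> Q u B x <= Q v B x),
             (forall t, 0 <= t -> (fun u => Q u B x) @ t^'+ --> Q t B x)
           & Q 0 B x = 0]),
      (forall t x, 0 <= t ->
         [/\ Q t set0 x = 0,
             (forall B, measurable B -> 0 <= Q t B x),
             semi_sigma_additive (fun B => (Q t B x)%:E)
           & Q t setT x <= 1])
    &
      (forall x, (fun t => Q t setT x) @ +oo --> (1 : R))].

Definition gen_sigma {dO} {Omega : measurableType dO}
  (gens : set (set Omega)) : set (set Omega) := <<s gens >>.

Definition hist_sigma {dO} {Omega : measurableType dO}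
  (X : nat -> Omega -> E) (Tt : nat -> Omega -> R) (n : nat) : set (set Omega) :=
  gen_sigma [set F | exists k, (k <= n)%N /\
     ((exists B : set E, measurable B /\ F = X k @^-1` B) \/
      (exists B : set R, measurable B /\ F = Tt k @^-1` B))].

Definition Ssum {Omega : Type} (Tt : nat -> Omega -> R) (n : nat) (w : Omega) : R :=
  \sum_(0 <= k < n.+1) Tt k w.

(* Step process: Z(t) = Z_n for S_n <= t < S_{n+1}; (default value y0 where
   no such n exists, i.e. beyond an explosion time -- a null event here) *)
Definition step_proc {Omega Y : Type} (y0 : Y) (Z : nat -> Omega -> Y)
  (S : nat -> Omega -> R) (w : Omega) (t : R) : Y :=
  match pselect (exists n, S n w <= t < S n.+1 w) with
  | left H => Z (projT1 (cid H)) w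
  | right _ => y0
  end.

Definition smp_law (Q : R -> set E -> E -> R) (x : E)
  {dO} {Omega : measurableType dO} (P : probability Omega R)
  (X : nat -> Omega -> E) (Tt : nat -> Omega -> R) : Prop :=
  [/\ (forall n, measurable_fun setT (X n)),
      (forall n, measurable_fun setT (Tt n)),
      {ae P, forall w, Tt 0 w = 0 /\ X 0 w = x}
    & (forall n (F : set Omega), hist_sigma X Tt n F ->
        forall t, 0 <= t -> forall B, measurable B ->
        P (F `&` ([set w | Tt n.+1 w <= t] `&` (X n.+1 @^-1` B))) =
        (\int[P]_(w in F) (Q t B (X n w))%:E)%E)].

Definition S_stop {Omega : Type} (Tt : nat -> Omega -> R)
  (tau : Omega -> option nat) (w : Omega) : \bar R :=
  match tau w with
  | Some n => (Ssum Tt n w)%:E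
  | None => limn (fun n => (Ssum Tt n w)%:E)
  end.

Definition reward (c g : E -> R) {Omega : Type}
  (X : nat -> Omega -> E) (Tt : nat -> Omega -> R)
  (tau : Omega -> option nat) (s : R) (w : Omega) : \bar R :=
  let Xt := step_proc point X (Ssum Tt) w in
  if (S_stop Tt tau w < s%:E)%E then
    (\int[@lebesgue_measure R]_(t in `[0%R, fine (S_stop Tt tau w)]) (c (Xt t))%:E
      + (g (Xt (fine (S_stop Tt tau w))))%:E)%E
  else (\int[@lebesgue_measure R]_(t in `[0%R, s]) (c (Xt t))%:E)%E.

Definition V_value (c g : E -> R) {dO} {Omega : measurableType dO}
  (P : probability Omega R) (X : nat -> Omega -> E) (Tt : nat -> Omega -> R)
  (tau : Omega -> option nat) (s : R) : \bar R :=
  \int[P]_w reward c g X Tt tau s w.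

(* Histories hat H_n = (x_0, a_0, t_1, x_1, ..., a_{n-1}, t_n, x_n),
   encoded as (x_0, [:: ((a_0,t_1),x_1); ...; ((a_{n-1},t_n),x_n)]);
   actions: false = 0 (continue), true = 1 (stop). *)
Definition hist (n : nat) :=
  (ehat E * n.-tuple ((bool * R) * ehat E))%type.

(* genuine elements of hat H_n: t_m in R_+ and a_m in A(x_m) *)
Definition valid_hist n (h : hist n) : Prop :=
  let xs := h.1 :: [seq p.2 | p <- tval h.2] in
  (forall m : 'I_n, 0 <= (tnth h.2 m).1.2) /\
  (forall m : 'I_n, nth Delta xs m = Delta -> (tnth h.2 m).1.1 = true).

Definition hist0 n (h : hist n) : Prop :=
  h.1 <> Delta /\
  (forall m : 'I_n, [/\ (tnth h.2 m).1.1 = false, 0 <= (tnth h.2 m).1.2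
                      & (tnth h.2 m).2 <> Delta]).

Definition det_policy (dp : forall n, R -> hist n -> bool) : Prop :=
  (forall n, measurable_fun setT (fun p : R * hist n => dp n p.1 p.2)) /\
  (forall n s (h : hist n), valid_hist h ->
     last h.1 [seq p.2 | p <- tval h.2] = Delta -> dp n s h = true).

Definition Pi0DH (dp : forall n, R -> hist n -> bool) : Prop :=
  det_policy dp /\ (forall n (h : hist n), hist0 h -> dp n 0 h = false).

Definition Qhat (Q : R -> set E -> E -> R) (T : R)
  (t : R) (B : set (ehat E)) (x : ehat E) (a : bool) : R :=
  match a, x with
  | false, Some y => Q t (@Some E @^-1` B) y
  | false, None => 0 (* not an admissible pair: A(Delta) = {1} *)
  | true, _ => (T + 1 <= t)%R%:R * (if pselect (B Delta) then 1 else 0)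
  end.

Definition chat (c : E -> R) (x : ehat E) (a : bool) : R :=
  match x, a with Some y, false => c y | _, _ => 0 end.

Definition ghat (g : E -> R) (x : ehat E) (a : bool) : R :=
  match x, a with Some y, true => g y | _, _ => 0 end.

Definition Yhat {Omega : Type} (Xh : nat -> Omega -> ehat E)
  (Ah : nat -> Omega -> bool) (Th : nat -> Omega -> R) (n : nat) (w : Omega)
  : hist n :=
  (Xh 0 w, [tuple ((Ah i w, Th i.+1 w), Xh i.+1 w) | i < n]).

Definition hist_sigma_hat {dO} {Omega : measurableType dO}
  (Xh : nat -> Omega -> ehat E) (Ah : nat -> Omega -> bool)
  (Th : nat -> Omega -> R) (n : nat) : set (set Omega) :=
  gen_sigma [set F | exists k, (k <= n)%N /\
     [\/ (exists B : set (ehat E), measurable B /\ F = Xh k @^-1` B),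
         (exists B : set R, measurable B /\ F = Th k @^-1` B)
       | (exists B : set bool, F = Ah k @^-1` B)]].

Definition smdp_law (Q : R -> set E -> E -> R) (T : R)
  (dp : forall n, R -> hist n -> bool) (s : R) (x : E)
  {dO} {Omega : measurableType dO} (P : probability Omega R)
  (Xh : nat -> Omega -> ehat E) (Ah : nat -> Omega -> bool)
  (Th : nat -> Omega -> R) : Prop :=
  [/\ (forall n, [/\ measurable_fun setT (Xh n),
                        measurable_fun setT (Ah n) & measurable_fun setT (Th n)]),
      {ae P, forall w, Xh 0 w = Some x /\ Th 0 w = 0},
      {ae P, forall w, forall n, Ah n w = dp n (s - Ssum Th n w) (Yhat Xh Ah Th n w)}
    & (forall n (F : set Omega), hist_sigma_hat Xh Ah Th n F ->
        forall t, 0 <= t -> forall B, measurable B ->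
        P (F `&` ([set w | Th n.+1 w <= t] `&` (Xh n.+1 @^-1` B))) =
        (\int[P]_(w in F) (Qhat Q T t B (Xh n w) (Ah n w))%:E)%E)].

Definition U_value (c g : E -> R) {dO} {Omega : measurableType dO}
  (P : probability Omega R) (Xh : nat -> Omega -> ehat E)
  (Ah : nat -> Omega -> bool) (Th : nat -> Omega -> R) (s : R) : \bar R :=
  \int[P]_w
    (let Xt := step_proc Delta Xh (Ssum Th) w in
     let At := step_proc true Ah (Ssum Th) w in
     \int[@lebesgue_measure R]_(t in `[0%R, s]) (chat c (Xt t) (At t))%:E
       + (ghat g (Xt s) (At s))%:E)%E.

Definition Y0 {Omega : Type} (X : nat -> Omega -> E) (Tt : nat -> Omega -> R)
  (n : nat) (w : Omega) : hist n :=
  (Some (X 0 w), [tuple ((false, Tt i.+1 w), Some (X i.+1 w)) | i < n]).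

Definition induced_stop (dp : forall n, R -> hist n -> bool) (s : R)
  {Omega : Type} (X : nat -> Omega -> E) (Tt : nat -> Omega -> R)
  (w : Omega) : option nat :=
  match pselect (exists n, dp n (s - Ssum Tt n w) (Y0 X Tt n w)) with
  | left H => Some (ex_minn H)
  | right _ => None
  end.

End defs.

(* Main.v *)
(** Up to the first decision to stop, the controlled process has the law of the
original one: the two histories, restricted to the event that no stop has been
decided before stage [n], have the same image measure, by induction on [n],
since the next step is drawn from the same kernel [Q] while the action is 0.
On both sides the payoff is almost surely the sum over [n] of the running gain
[c(X_n) * |[S_n, S_(n+1)[ `&` [0, s]|] earned if no stop has been decided up to
stage [n], and of the terminal gain [g(X_n)] earned if the stop occurs at stage
[n] with [S_n < s]; each term is a function of a history.  The bound
[Q(delta, E|x) <= 1 - eps] makes infinitely many sojourn times exceed a fixed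
positive constant, so neither process explodes.  After a stop the next sojourn
time exceeds [T >= s], so the decision is still in force at time [s]; and
[d_n(0, .) = 0] excludes a stop exactly at [S_n = s], the only case in which the
two payoffs could differ. *)

Require Import Defs.
From HB Require Import structures.
From mathcomp Require Import all_boot all_order all_algebra.
From mathcomp Require Import all_classical all_reals all_analysis.
From mathcomp Require Import measurable_realfun lra.
Set Implicit Arguments. Unset Strict Implicit. Unset Printing Implicit Defensive.
Import Order.TTheory GRing.Theory Num.Theory.
Import numFieldNormedType.Exports.
Local Open Scope classical_set_scope.
Local Open Scope ring_scope.

(** * Comparison of integrals of nonnegative functions, measurable or not *)

(** The integral is a supremum over the simple functions lying below the integrand, and a larger
    integrand admits more of them. *)
Lemma le_integral_ge0 d (T : measurableType d) (R : realType)
    (mu : {measure set T -> \bar R}) (f g : T -> \bar R) :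
  (forall x, 0 <= f x)%E -> (forall x, f x <= g x)%E ->
  (\int[mu]_x f x <= \int[mu]_x g x)%E.
Proof.
move=> f0 fg; have g0 x : (0 <= g x)%E by exact: le_trans (fg x).
rewrite !ge0_integralTE//; apply: ereal_sup_le => _ [h /= hf <-].
by exists h => // x; exact: le_trans (fg x).
Qed.

(** The rewards are only a.e. equal to measurable functions, so [f] is not
    assumed measurable. *)
Lemma ge0_ae_eq_integral_nonmeasurable d (T : measurableType d) (R : realType)
    (mu : {measure set T -> \bar R}) (f g : T -> \bar R) :
  (forall x, 0 <= f x)%E -> (forall x, 0 <= g x)%E -> measurable_fun setT g ->
  {ae mu, forall x, f x = g x} -> (\int[mu]_x f x = \int[mu]_x g x)%E.
Proof.
move=> f0 g0 mg [N [mN muN fgN]].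
have fgE x : ~ N x -> f x = g x by move=> Nx; apply: contrapT => /fgN.
apply/eqP; rewrite eq_le; apply/andP; split.
  (* A measurable majorant of [f] that differs from [g] only on the null set [N]. *)
  pose h := (fun x => if x \in N then +oo%E else g x).
  have mh : measurable_fun setT h.
    apply: measurable_fun_if => //.
    - by apply: (measurable_fun_bool true); rewrite setTI preimage_mem_true.
    - exact: measurable_funS mg.
  rewrite (_ : (\int[mu]_x g x)%E = (\int[mu]_x h x)%E).
    apply: le_integral_ge0 => // x; rewrite /h; case: ifPn => [_|].
      exact: leey.
    by rewrite notin_setE => /fgE ->.
  apply: ge0_ae_eq_integral => //.
    by move=> x _; rewrite /h; case: ifPn.
  exists N; split => // x /=; apply: contra_notP => Nx _.
  by rewrite /h ifF//; apply/negbTE; rewrite notin_setE.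
(* For the other inequality, [g] restricted to the complement of [N] lies below [f]. *)
rewrite (ge0_negligible_integral mN)//.
rewrite integral_mkcond; apply: le_integral_ge0 => x.
  by apply: erestrict_ge0 => y _; exact: g0.
rewrite patchE; case: ifPn => //; rewrite inE => -[_ Nx].
by rewrite fgE.
Qed.

(** * Uniqueness of finite measures on the space of a history and its next step *)

Section uniqueness.
Context d1 d2 (T1 : measurableType d1) (T2 : measurableType d2) (R : realType).

(** The middle factor is a half-line because the laws prescribe the next step through events of the
    form [T_(n+1) <= t]. *)
Let rect : set (set (T1 * (R * T2))) :=
  [set C | exists A t B, [/\ measurable A, measurable B &
    C = A `*` (`]-oo, t] `*` B)]].

Let rectI : setI_closed rect.
Proof.
move=> _ _ [A [t [B [mA mB ->]]]] [A' [t' [B' [mA' mB' ->]]]].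
exists (A `&` A'), (Num.min t t'), (B `&` B'); split; [exact: measurableI..|].
apply/seteqP; split => -[a [u b]] /=; rewrite !in_itv/= le_min.
  by move=> [[? [? ?]] [? [-> ?]]]; do !split => //; apply/andP.
by move=> [[? ?] [/andP[? ?] [? ?]]]; do !split.
Qed.

Let strip (A : set T1) (B : set T2) (k : nat) := A `*` ((`]-oo, k%:R : R] : set R) `*` B).

Let strip_cover (A : set T1) (B : set T2) :
  \bigcup_k strip A B k = A `*` (setT `*` B).
Proof.
apply/seteqP; split => -[a [u b]] /=; first by move=> [k _ [? [_ ?]]].
move=> [? [_ ?]]; exists (Num.truncn `|u|).+1 => //; do !split => //=.
rewrite in_itv/= (le_trans (ler_norm _))//.
by rewrite ltW// truncnS_gt.
Qed.

Let rect_measurable : @measurable _ (T1 * (R * T2))%type = <<s rect >>.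
Proof.
rewrite eqEsubset; split; last first.
  apply: smallest_sub; first exact: sigma_algebra_measurable.
  move=> _ [A [t [B [mA mB ->]]]].
  by apply: measurableX => //; apply: measurableX => //; exact: measurable_itv.
pose GT := g_sigma_algebraType rect.
have mstrip A B : measurable A -> measurable B ->
    measurable (A `*` (setT `*` B) : set GT).
  move=> mA mB; rewrite -strip_cover; apply: bigcupT_measurable => k.
  by apply: sub_sigma_algebra; exists A, k%:R, B.
(* The product sigma-algebra is contained in the generated one as soon as the identity out of the
   latter is measurable, which is checked on each coordinate. *)
suff mid : measurable_fun (setT : set GT) (fun z : GT => (z : T1 * (R * T2))).
  by move=> C mC; have := mid measurableT C mC; rewrite setTI.
apply/measurable_fun_pairP; split.
  move=> _ A mA; rewrite setTI.
  rewrite (_ : _ @^-1` A = A `*` (setT `*` setT)); first exact: mstrip.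
  by apply/seteqP; split => -[a [u b]] //= [].
apply/measurable_fun_pairP; split.
  apply: (@measurability _ _ _ _ _ _ (@RGenOInfty.G R)).
    exact: RGenOInfty.measurableE.
  move=> _ [_ [x ->] <-]; rewrite setTI -setCitvl preimage_setC.
  apply: measurableC; apply: sub_sigma_algebra; exists setT, x, setT; split => //.
  by apply/seteqP; split => -[a [u b]] //= [_ []].
move=> _ B mB; rewrite setTI.
rewrite (_ : _ @^-1` B = setT `*` (setT `*` B)); first exact: mstrip.
by apply/seteqP; split => -[a [u b]] //= [_ []].
Qed.

(** Uniqueness on a generating pi-system: [rect] is stable under intersection, and the strips, of
    finite measure, exhaust the space. *)
Lemma finite_measure_rect_unique
    (m1 m2 : {measure set (T1 * (R * T2))%type -> \bar R}) :
  (m1 setT < +oo)%E ->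
  (forall A t B, measurable A -> measurable B ->
    m1 (A `*` (`]-oo, t] `*` B)) = m2 (A `*` (`]-oo, t] `*` B))) ->
  forall C, measurable C -> m1 C = m2 C.
Proof.
move=> m1oo m12 C mC.
apply: (measure_unique rect (strip setT setT)) => //.
- by move=> k; exists setT, k%:R, setT.
- by rewrite strip_cover !setXTT.
- by move=> _ [A [t [B [mA mB ->]]]]; exact: m12.
- move=> k; apply: le_lt_trans m1oo; apply: le_measure; rewrite ?inE//.
  by apply: measurableX => //; apply: measurableX => //; exact: measurable_itv.
Qed.

End uniqueness.

(** * Almost sure equality of events and transport of integrals *)

Lemma ae_eq_measure d (T : measurableType d) (R : realType)
    (mu : {measure set T -> \bar R}) (A B : set T) :
  measurable A -> measurable B -> {ae mu, forall x, A x <-> B x} -> mu A = mu B.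
Proof.
move=> mA mB AB.
rewrite -[A](setIT) -[B](setIT).
rewrite -(integral_indic mu measurableT mA) -(integral_indic mu measurableT mB).
apply: ge0_ae_eq_integral => //.
- exact/measurable_EFinP/measurable_indic.
- exact/measurable_EFinP/measurable_indic.
apply: filterS AB => x AB _; congr EFin; rewrite !indicE; congr (_%:R).
by congr nat_of_bool; apply/idP/idP; rewrite !inE => /AB.
Qed.

Lemma measure0_aeN d (T : measurableType d) (R : realType)
    (mu : {measure set T -> \bar R}) (A : set T) :
  measurable A -> mu A = 0%E -> {ae mu, forall x, ~ A x}.
Proof. by move=> mA A0; exists A; split => // x /= /contrapT. Qed.

(** The restricted measure does not charge the complement of [F], so the change of variables over
    the whole space only sees [F]. *)
Lemma integral_pushforward_mrestr d (T : measurableType d) dH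
    (H : measurableType dH) (R : realType) (mu : {measure set T -> \bar R})
    (F : set T) (Y : T -> H) (f : H -> \bar R) (mF : measurable F) :
  measurable_fun setT Y -> measurable_fun setT f -> (forall h, 0 <= f h)%E ->
  (\int[pushforward (mrestr mu mF) Y]_h f h = \int[mu]_(x in F) f (Y x))%E.
Proof.
move=> mY mf f0; rewrite ge0_integral_pushforward// preimage_setT.
have mfY : measurable_fun setT (f \o Y) by exact: measurableT_comp.
rewrite (ge0_negligible_integral (measurableC mF))//; last 2 first.
- by move=> x _; exact: f0.
- by rewrite /= /mrestr setICl measure0.
rewrite setTD setCK; apply: eq_measure_integral => A mA AF.
by rewrite /= /mrestr setIidl.
Qed.

(** Both sides integrate [f] against one measure on [H], the image by [Y] of [mu] restricted to [F].
    In this form equality of the laws of histories yields equality of expected gains. *)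
Lemma eq_integral_transport d (T : measurableType d) d' (T' : measurableType d')
    dH (H : measurableType dH) (R : realType) (mu : {measure set T -> \bar R})
    (mu' : {measure set T' -> \bar R}) (F : set T) (F' : set T')
    (Y : T -> H) (Y' : T' -> H) (f : H -> \bar R) :
  measurable F -> measurable F' ->
  measurable_fun setT Y -> measurable_fun setT Y' -> measurable_fun setT f ->
  (forall h, 0 <= f h)%E ->
  (forall B, measurable B -> mu (F `&` Y @^-1` B) = mu' (F' `&` Y' @^-1` B)) ->
  (\int[mu]_(x in F) f (Y x) = \int[mu']_(x in F') f (Y' x))%E.
Proof.
move=> mF mF' mY mY' mf f0 FYB.
rewrite -(integral_pushforward_mrestr _ mF)// -(integral_pushforward_mrestr _ mF')//.
apply: eq_measure_integral => B mB _. rewrite /= /mrestr /pushforward.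
by rewrite !(setIC (_ @^-1` B)) FYB.
Qed.

(** * Coordinates of a history and its extension by one step *)

Section histories.
Context {R : realType} {dE : measure_display} {E : measurableType dE}.

Local Notation Hist := (@hist R dE E).

(** A subset of [ehat E] is measurable exactly when its trace on [E] is. *)
Lemma measurable_fun_ehat d (T : measurableType d) (f : ehat E -> T) :
  measurable_fun setT (f \o Some) -> measurable_fun setT f.
Proof.
move=> mf _ B mB; rewrite setTI.
by have := mf measurableT B mB; rewrite setTI.
Qed.

Lemma measurable_Some : measurable_fun setT (@Some E : E -> ehat E).
Proof. by move=> _ B mB; rewrite setTI. Qed.

Lemma measurable_nth d (T : measurableType d) n (x0 : T) k :
  measurable_fun setT (fun t : n.-tuple T => nth x0 t k).
Proof.
have [kn|kn] := ltnP k n; last first.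
  rewrite (_ : (fun _ => _) = cst x0)//; apply/funext => t.
  by rewrite nth_default// size_tuple.
rewrite (_ : (fun _ => _) = (@tnth n T)^~ (Ordinal kn)).
  exact: measurable_tnth.
by apply/funext => t; rewrite (tnth_nth x0).
Qed.

Definition hist_item n (h : Hist n) (k : nat) : bool * R * ehat E :=
  nth (false, 0, Delta) h.2 k.

Definition hist_state n (h : Hist n) (k : nat) : ehat E :=
  if k is j.+1 then (hist_item h j).2 else h.1.

(** A history does not record [T_0]; index 0 gets the value 0 that [T_0] takes almost surely. Hence
    the assumption [Tt 0 w = 0] wherever [hist_epoch] is identified with [Ssum]. *)
Definition hist_time n (h : Hist n) (k : nat) : R :=
  if k is j.+1 then (hist_item h j).1.2 else 0.

Definition hist_epoch n (h : Hist n) (k : nat) : R :=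
  \sum_(0 <= j < k.+1) hist_time h j.

(** The appended action is [false]: histories are extended only while the policy continues. *)
Definition hist_rcons n (z : Hist n * (R * ehat E)) : Hist n.+1 :=
  (z.1.1, [tuple if (i < n)%N then hist_item z.1 i
                 else ((false, z.2.1), z.2.2) | i < n.+1]).

Lemma measurable_hist_item n k : measurable_fun setT (fun h : Hist n => hist_item h k).
Proof.
refine (measurableT_comp (@measurable_nth _ (bool * R * ehat E)%type n
  (false, 0, Delta) k) _).
exact: measurable_snd.
Qed.

Lemma measurable_hist_state n k : measurable_fun setT (fun h : Hist n => hist_state h k).
Proof.
case: k => [|k] /=; first exact: measurable_fst.
by have /measurable_fun_pairP[] := @measurable_hist_item n k.
Qed.

Lemma measurable_hist_time n k : measurable_fun setT (fun h : Hist n => hist_time h k).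
Proof.
case: k => [|k] /=; first exact: measurable_cst.
have /measurable_fun_pairP[+ _] := @measurable_hist_item n k.
by move=> /measurable_fun_pairP[].
Qed.

Lemma measurable_hist_epoch n k : measurable_fun setT (fun h : Hist n => hist_epoch h k).
Proof. by apply: measurable_sum => i; exact: measurable_hist_time. Qed.

Lemma measurable_hist_rcons n : measurable_fun setT (@hist_rcons n).
Proof.
have m1 : measurable_fun setT (fun z : Hist n * (R * ehat E) => z.1).
  exact: measurable_fst.
have m2 : measurable_fun setT (fun z : Hist n * (R * ehat E) => z.2).
  exact: measurable_snd.
move/measurable_fun_pairP: (m1) => [m11 _].
move/measurable_fun_pairP: m2 => [m21 m22].
apply/measurable_fun_pairP; split => //.
apply/measurable_fun_tnthP => i.
rewrite (_ : _ \o _ = fun z : Hist n * (R * ehat E) =>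
    if (i < n)%N then hist_item z.1 i else (false, z.2.1, z.2.2)); last first.
  by apply/funext => z /=; rewrite tnth_mktuple.
case: (i < n)%N.
  exact: (measurableT_comp (@measurable_hist_item n i) m1).
by apply: measurable_fun_pair => //; exact: measurable_fun_pair.
Qed.

Section process.
Context {Omega : Type} (X : nat -> Omega -> ehat E) (A : nat -> Omega -> bool)
  (Tt : nat -> Omega -> R).

Lemma hist_item_Yhat n w k : (k < n)%N ->
  hist_item (Yhat X A Tt n w) k = (A k w, Tt k.+1 w, X k.+1 w).
Proof.
move=> kn; rewrite /hist_item.
by have := tnth_nth (false, 0, Delta) (Yhat X A Tt n w).2 (Ordinal kn);
  rewrite tnth_mktuple => <-.
Qed.

Lemma hist_state_Yhat n w k : (k <= n)%N -> hist_state (Yhat X A Tt n w) k = X k w.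
Proof. by case: k => [//|k] kn; rewrite /= hist_item_Yhat. Qed.

Lemma hist_epoch_Yhat n w k : (k <= n)%N -> Tt 0 w = 0 ->
  hist_epoch (Yhat X A Tt n w) k = Ssum Tt k w.
Proof.
move=> kn T0; apply: eq_big_nat => -[|j] /andP[_ jk]; first by rewrite T0.
by rewrite /= hist_item_Yhat// (leq_trans _ kn).
Qed.

Lemma hist_rcons_Yhat n w : A n w = false ->
  Yhat X A Tt n.+1 w = hist_rcons (Yhat X A Tt n w, (Tt n.+1 w, X n.+1 w)).
Proof.
move=> An; congr pair; apply: eq_from_tnth => i; rewrite !tnth_mktuple /=.
case: ifPn => [?|]; first by rewrite hist_item_Yhat.
rewrite -leqNgt => ni; have -> : nat_of_ord i = n.
  by apply/eqP; rewrite eqn_leq ni -ltnS ltn_ord.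
by rewrite An.
Qed.

End process.

Lemma measurable_Yhat dO (Omega : measurableType dO) (X : nat -> Omega -> ehat E)
    (A : nat -> Omega -> bool) (Tt : nat -> Omega -> R) n :
  (forall k, (k <= n)%N -> measurable_fun setT (X k)) ->
  (forall k, (k <= n)%N -> measurable_fun setT (A k)) ->
  (forall k, (k <= n)%N -> measurable_fun setT (Tt k)) ->
  measurable_fun setT (Yhat X A Tt n).
Proof.
move=> mX mA mT; apply/measurable_fun_pairP; split; first exact: mX.
apply/measurable_fun_tnthP => i.
rewrite (_ : _ \o _ = fun w => (A i w, Tt i.+1 w, X i.+1 w)); last first.
  by apply/funext => w /=; rewrite tnth_mktuple.
apply: measurable_fun_pair; last exact: mX.
by apply: measurable_fun_pair; [apply: mA; rewrite ltnW|exact: mT].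
Qed.

End histories.

(** * A common framework for the controlled and the uncontrolled process *)

Section jump.
Context {R : realType} {dE : measure_display} {E : measurableType dE}.
Local Notation Hist := (@hist R dE E).

(** [smdp_law] without the policy; it also covers the uncontrolled process, with
    states [Some (X n)] and constant action [false]. *)
Definition jump_law (Q : R -> set E -> E -> R) (T : R) (x : E)
  {dO} {Omega : measurableType dO} (P : probability Omega R)
  (X : nat -> Omega -> ehat E) (A : nat -> Omega -> bool)
  (Tt : nat -> Omega -> R) : Prop :=
  [/\ (forall n, [/\ measurable_fun setT (X n), measurable_fun setT (A n)
                   & measurable_fun setT (Tt n)]),
      {ae P, forall w, X 0 w = Some x /\ Tt 0 w = 0}
    & (forall n (F : set Omega), hist_sigma_hat X A Tt n F ->
        forall t, 0 <= t -> forall B, measurable B ->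
        P (F `&` ([set w | Tt n.+1 w <= t] `&` (X n.+1 @^-1` B))) =
        (\int[P]_(w in F) (Qhat Q T t B (X n w) (A n w))%:E)%E)].

(** The remaining horizon is computed from the history itself, so that the decision is a function of
    the history alone. *)
Definition stop_at (dp : forall n, R -> Hist n -> bool) (s : R) n (h : Hist n) : bool :=
  dp n (s - hist_epoch h n) h.

Lemma measurable_stop_at (dp : forall n, R -> Hist n -> bool) s n :
  (forall n, measurable_fun setT (fun p : R * Hist n => dp n p.1 p.2)) ->
  measurable_fun setT (@stop_at dp s n).
Proof.
move=> mdp.
have mp : measurable_fun setT (fun h : Hist n => (s - hist_epoch h n, h)).
  apply: measurable_fun_pair => //.
  by apply: measurable_funB => //; exact: measurable_hist_epoch.
exact: (measurableT_comp (mdp n) mp).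
Qed.

Section kernel.
Context (Q : R -> set E -> E -> R) (T : R).
Hypothesis hQ : semi_markov_kernel Q.
Hypothesis T0 : 0 <= T.

Lemma Qhat_ge0 t B y a : 0 <= t -> measurable B -> 0 <= Qhat Q T t B y a.
Proof.
move=> t0 mB; case: a => /=; first by case: pselect => ?; rewrite ?mulr1 ?mulr0 ?ler0n.
by case: y => [y|//]; have [_ _ + _] := hQ; move=> /(_ t y t0)[_ + _ _]; apply.
Qed.

Lemma Qhat0 B y a : measurable B -> Qhat Q T 0 B y a = 0.
Proof.
move=> mB; case: a => /=; first by rewrite leNgt ltr_wpDl// mul0r.
by case: y => [y|//]; have [_ + _ _] := hQ; move=> /(_ _ y mB)[_ _].
Qed.

Lemma measurable_Qhat t B : 0 <= t -> measurable B ->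
  measurable_fun setT (fun y => Qhat Q T t B y false).
Proof.
move=> t0 mB; apply: measurable_fun_ehat.
by have [+ _ _ _] := hQ; move=> /(_ t (@Some E @^-1` B) t0 mB).
Qed.

Lemma Qhat_contraction :
  (exists delta eps : R, [/\ 0 < delta, 0 < eps &
     forall y : E, Q delta setT y <= 1 - eps]) ->
  exists delta q : R, [/\ 0 < delta, 0 <= q, q < 1 &
     forall y a, Qhat Q T delta setT y a <= q].
Proof.
move=> [delta [eps [delta0 eps0 Qle]]].
(* A time of at most 1/2 stays below the atom [T + 1] of the stopping action, which thus has mass 0
   there; the continuing action keeps its bound by monotonicity in time. The maximum with 0 makes
   the bound valid in these null cases too. *)
exists (Num.min delta (1/2)), (Num.max (1 - eps) 0); split.
- by rewrite lt_min delta0; lra.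
- by rewrite le_max lexx orbT.
- by rewrite gt_max; apply/andP; split; lra.
move=> y [] /=.
  have /lt_geF-> : Num.min delta (1/2) < T + 1.
    rewrite gt_min; apply/orP; right; move: T0 => T0'; lra.
  by rewrite mul0r le_max lexx orbT.
case: y => [y|]; last by rewrite le_max lexx orbT.
rewrite le_max; apply/orP; left; apply: le_trans (Qle y).
have [_ + _ _] := hQ => /(_ _ y measurableT)[+ _ _]; apply.
  by rewrite le_min ltW//; lra.
by rewrite ge_min lexx.
Qed.

End kernel.

Section live.
Context {Omega : Type} (X : nat -> Omega -> ehat E) (A : nat -> Omega -> bool)
  (Tt : nat -> Omega -> R) (dp : forall n, R -> Hist n -> bool) (s : R).

(** Expressed through the policy and not through the actions, which are constantly [false] in the
    uncontrolled process; the same events can then be compared on both sides. *)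
Fixpoint live (n : nat) : set Omega :=
  if n is m.+1 then live m `&` [set w | stop_at dp s (Yhat X A Tt m w) = false]
  else setT.

Lemma liveP n w : live n w <->
  forall i, (i < n)%N -> stop_at dp s (Yhat X A Tt i w) = false.
Proof.
elim: n => [//|n [IH1 IH2]] /=; split.
  by move=> [ln sn] i; rewrite ltnS leq_eqVlt => /predU1P[->//|]; exact: IH1.
by move=> sw; split; [apply: IH2 => i /ltnW/sw|exact: sw].
Qed.

(** The generators of [hist_sigma_hat], named so that the past can be made a measurable type of its
    own. *)
Definition hist_gens n : set (set Omega) :=
  [set F | exists k, (k <= n)%N /\
     [\/ (exists B : set (ehat E), measurable B /\ F = X k @^-1` B),
         (exists B : set R, measurable B /\ F = Tt k @^-1` B)
       | (exists B : set bool, F = A k @^-1` B)]].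

End live.

(** Measurability is asked of the coordinates below [n] only, so that the statement applies to the
    sigma-algebra of the past as well as to the ambient one. *)
Lemma measurable_live dO (Omega : measurableType dO) (X : nat -> Omega -> ehat E)
    (A : nat -> Omega -> bool) (Tt : nat -> Omega -> R)
    (dp : forall n, R -> Hist n -> bool) s n :
  (forall n, measurable_fun setT (fun p : R * Hist n => dp n p.1 p.2)) ->
  (forall k, (k < n)%N -> measurable_fun setT (X k)) ->
  (forall k, (k < n)%N -> measurable_fun setT (A k)) ->
  (forall k, (k < n)%N -> measurable_fun setT (Tt k)) ->
  measurable (live X A Tt dp s n).
Proof.
move=> mdp; elim: n => [|n IH] mX mA mT /=; first exact: measurableT.
apply: measurableI; first by apply: IH => k /ltnW; [exact: mX|exact: mA|exact: mT].
have mst : measurable_fun setT (fun w => stop_at dp s (Yhat X A Tt n w)).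
  apply: (measurableT_comp (measurable_stop_at s mdp)).
  exact: measurable_Yhat.
have := mst measurableT [set false] Logic.I; rewrite setTI.
by congr measurable; apply/seteqP; split.
Qed.

End jump.

(** * Almost sure properties of the paths *)

Section jump_process.
Context {R : realType} {dE : measure_display} {E : measurableType dE}.
Local Notation Hist := (@hist R dE E).
Context (Q : R -> set E -> E -> R) (T : R) (x : E).
Context {dO} {Omega : measurableType dO} (P : probability Omega R)
  (X : nat -> Omega -> ehat E) (A : nat -> Omega -> bool) (Tt : nat -> Omega -> R).
Hypothesis hQ : semi_markov_kernel Q.
Hypothesis T0 : 0 <= T.
Hypothesis law : jump_law Q T x P X A Tt.

Let mX n : measurable_fun setT (X n). Proof. by have [+ _ _] := law => /(_ n)[]. Qed.
Let mA n : measurable_fun setT (A n). Proof. by have [+ _ _] := law => /(_ n)[]. Qed.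
Let mT n : measurable_fun setT (Tt n). Proof. by have [+ _ _] := law => /(_ n)[]. Qed.

Local Notation sigma n := (g_sigma_algebraType (hist_gens X A Tt n)).

Lemma sigmaX n k : (k <= n)%N -> measurable_fun (setT : set (sigma n)) (X k).
Proof.
move=> kn _ B mB; rewrite setTI; apply: sub_sigma_algebra.
by exists k; split => //; apply: Or31; exists B.
Qed.

Lemma sigmaA n k : (k <= n)%N -> measurable_fun (setT : set (sigma n)) (A k).
Proof.
move=> kn _ B mB; rewrite setTI; apply: sub_sigma_algebra.
by exists k; split => //; apply: Or33; exists B.
Qed.

Lemma sigmaT n k : (k <= n)%N -> measurable_fun (setT : set (sigma n)) (Tt k).
Proof.
move=> kn _ B mB; rewrite setTI; apply: sub_sigma_algebra.
by exists k; split => //; apply: Or32; exists B.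
Qed.

Lemma sigmaT_le n k (t : R) : (k <= n)%N ->
  hist_sigma_hat X A Tt n [set w | Tt k w <= t].
Proof.
move=> kn; have := sigmaT kn measurableT (measurable_itv `]-oo, t]).
by rewrite setTI; congr (_ _); apply/seteqP; split => w /=; rewrite in_itv.
Qed.

Lemma hist_sigma_hat_measurable n F : hist_sigma_hat X A Tt n F -> measurable F.
Proof.
apply: (smallest_sub (sigma_algebra_measurable _)) => _ [k [_ [[B [mB ->]]|[B [mB ->]]|[B ->]]]].
- by rewrite -[_ @^-1` _]setTI; exact: mX.
- by rewrite -[_ @^-1` _]setTI; exact: mT.
- by rewrite -[_ @^-1` _]setTI; exact: mA.
Qed.

Lemma jump_measure0 n F t B : hist_sigma_hat X A Tt n F -> 0 <= t -> measurable B ->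
  (forall w, F w -> Qhat Q T t B (X n w) (A n w) = 0) ->
  P (F `&` ([set w | Tt n.+1 w <= t] `&` (X n.+1 @^-1` B))) = 0%E.
Proof.
move=> sF t0 mB Q0; have [_ _ ->//] := law.
by apply: integral0_eq => w Fw; rewrite Q0.
Qed.

Let mTle n t : measurable [set w | Tt n w <= t].
Proof. exact: hist_sigma_hat_measurable (sigmaT_le t (leqnn n)). Qed.

Let mXB n B : measurable B -> measurable (X n @^-1` B).
Proof. by move=> mB; rewrite -[_ @^-1` _]setTI; exact: mX. Qed.

Let sA n a : hist_sigma_hat X A Tt n [set w | A n w = a].
Proof. by have := sigmaA (leqnn n) measurableT (Y := [set a]) Logic.I; rewrite setTI. Qed.

(** The kernel vanishes at time 0, whatever the state and the action. *)
Lemma ae_time_gt0 : {ae P, forall w n, 0 < Tt n.+1 w}.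
Proof.
apply: ae_foralln => n.
have := @jump_measure0 n setT 0 setT _ (lexx 0) measurableT.
rewrite preimage_setT setIT setTI => H.
apply: filterS (measure0_aeN (mTle n.+1 0) (H _ _)).
- by move=> w /= /negP; rewrite -ltNge.
- exact: (@measurableT _ (sigma n)).
- by move=> w _; rewrite (Qhat0 hQ).
Qed.

Lemma ae_stop_time_gt : {ae P, forall w n, A n w = true -> T < Tt n.+1 w}.
Proof.
apply: ae_foralln => n.
(* Any time in [[T, T + 1[] beyond [T] is reached before the atom [T + 1] of the stopping action;
   [T + 1/2] is one. *)
have T2 : 0 <= T + 1/2 by move: T0 => ?; lra.
have H := @jump_measure0 n _ (T + 1/2) setT (@sA n true) T2 measurableT.
have := measure0_aeN _ (H _); rewrite preimage_setT setIT => /(_ _ _)/filterS; apply.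
- move=> w /= Aw An; rewrite ltNge; apply: contra_notN Aw => TT; split => //.
  by apply: le_trans TT _; lra.
- by apply: measurableI => //; exact: hist_sigma_hat_measurable (@sA _ _).
- move=> w /= ->; rewrite /= (_ : T + 1 <= _ = false) ?mul0r//.
  by apply/negbTE; rewrite -ltNge; lra.
Qed.

(** Under the continuing action the kernel gives no mass to [Delta]. The law speaks of bounded
    sojourn times, hence the exhaustion by the integers [k]. *)
Lemma ae_continue_state : {ae P, forall w n, A n w = false -> X n.+1 w <> Delta}.
Proof.
apply: ae_foralln => n.
have mD : measurable [set @Delta E].
  by rewrite /measurable/= /ehat_measurable (_ : _ @^-1` _ = set0)//; apply/seteqP; split.
have H k := @jump_measure0 n _ k%:R _ (@sA n false) (ler0n R k) mD.
have : {ae P, forall w (k : nat), A n w = false -> Tt n.+1 w <= k%:R -> X n.+1 w <> Delta}.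
  apply: ae_foralln => k.
  have := measure0_aeN _ (H k _) => /(_ _ _)/filterS; apply.
  - by move=> w /= Aw An TT XD; exact: Aw.
  - apply: measurableI; first exact: hist_sigma_hat_measurable (@sA _ _).
    by apply: measurableI => //; exact: mXB.
  - move=> w /= ->; case: (X n w) => [y|//] /=.
    rewrite (_ : _ @^-1` _ = set0); last by apply/seteqP; split.
    by have [_ _ + _] := hQ => /(_ k%:R y (ler0n R k))[].
apply: filterS => w Hw An; apply: (Hw (Num.truncn `|Tt n.+1 w|).+1 An).
by rewrite (le_trans (ler_norm _))// ltW// truncnS_gt.
Qed.

(** A run of [k] consecutive sojourns of length at most [delta] has probability at most [q ^+ k];
    so, almost surely, long sojourns keep occurring and the epochs pass every multiple of
    [delta]. *)
Lemma ae_epoch_unbounded :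
  (exists delta eps : R, [/\ 0 < delta, 0 < eps &
     forall y : E, Q delta setT y <= 1 - eps]) ->
  {ae P, forall w (M : R), exists n, M < Ssum Tt n w}.
Proof.
move=> /(Qhat_contraction hQ T0)[delta [q [delta0 q0 q1 Qq]]].
pose B m k := [set w | forall j, (j < k)%N -> Tt (m + j).+1 w <= delta].
(* Short runs belong to the past, which permits conditioning on them. *)
have sB m k n : (m + k <= n)%N -> hist_sigma_hat X A Tt n (B m k).
  elim: k => [|k IH] mkn.
    rewrite (_ : B m 0 = setT); first exact: (@measurableT _ (sigma n)).
    by apply/seteqP; split.
  rewrite (_ : B m k.+1 = B m k `&` [set w | Tt (m + k).+1 w <= delta]).
    apply: (@measurableI _ (sigma n)).
      by apply: IH; rewrite (leq_trans _ mkn)// leq_add2l.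
    by apply: sigmaT_le; rewrite -addnS.
  apply/seteqP; split => w /= => [Bw|[Bw ?] j].
    by split; [move=> j /ltnW/Bw|exact: Bw].
  by rewrite ltnS leq_eqVlt => /predU1P[->//|]; exact: Bw.
have mB m k : measurable (B m k) by exact: hist_sigma_hat_measurable (sB _ _ _ (leqnn _)).
(* Each further short sojourn costs a factor [q], uniformly in the state and the action. *)
have PB m k : (P (B m k) <= (q ^+ k)%:E)%E.
  elim: k => [|k IH]; first by rewrite expr0 probability_le1.
  rewrite (_ : B m k.+1 = B m k `&` ([set w | Tt (m + k).+1 w <= delta] `&` X (m + k).+1 @^-1` setT)).
    have [_ _ ->//] := law; [|exact: sB|exact: ltW].
    apply: (@le_trans _ _ (\int[P]_(w in B m k) q%:E)%E).
      rewrite integral_mkcond [leRHS]integral_mkcond; apply: le_integral_ge0.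
        by move=> w; apply: erestrict_ge0 => y _; rewrite lee_fin (Qhat_ge0 T hQ)// ltW.
      by move=> w; rewrite !patchE; case: ifPn => // _; rewrite lee_fin.
    by rewrite integral_cst// exprS EFinM lee_wpmul2l// lee_fin.
  rewrite preimage_setT setIT; apply/seteqP; split => w /= => [Bw|[Bw ?] j].
    by split; [move=> j /ltnW/Bw|exact: Bw].
  by rewrite ltnS leq_eqVlt => /predU1P[->//|]; exact: Bw.
have aeB : {ae P, forall w m, exists j, delta < Tt (m + j).+1 w}.
  (* If no sojourn after stage [m] is long, all the [B m k] occur together; their intersection is
     null since [q ^+ k] tends to 0. *)
  apply: ae_foralln => m; exists (\bigcap_k B m k); split.
  - exact: bigcapT_measurable.
  - apply/eqP; rewrite eq_le measure_ge0 andbT; apply/lee_addgt0Pr => e e0.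
    have : q ^+ n @[n --> \oo] --> 0 by apply: cvg_expr; rewrite ger0_norm.
    move=> /cvgrPdist_lt/(_ e e0)[k _ /(_ k (leqnn k))]; rewrite sub0r normrN => qk.
    rewrite add0e; apply: le_trans (_ : P (B m k) <= _)%E.
      apply: le_measure; rewrite ?inE//; first exact: bigcapT_measurable.
      exact: bigcap_inf.
    by apply: le_trans (PB m k) _; rewrite lee_fin ltW// (le_lt_trans (ler_norm _)).
  - move=> w /= nw k _ j _; rewrite leNgt; apply: contra_notN nw => ?.
    by exists j.
have [_ ae0 _] := law.
have := ae_time_gt0; apply: filterS3 ae0 aeB => w [_ w0] wB wT M.
have S_nd m n : (m <= n)%N -> Ssum Tt m w <= Ssum Tt n w.
  move=> mn; rewrite /Ssum [leRHS](@big_cat_nat _ _ _ m.+1)//= lerDl.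
  by rewrite big_nat sumr_ge0// => -[//|i] _; exact/ltW/wT.
have Sk k : exists n, delta * k%:R <= Ssum Tt n w.
  elim: k => [|k [n IH]].
    by exists 0; rewrite mulr0 /Ssum big_nat1 w0.
  have [j nj] := wB n; exists (n + j).+1.
  rewrite /Ssum big_nat_recr//= -natr1 mulrDr mulr1 lerD ?(ltW nj)//.
  by apply: le_trans IH _; apply: S_nd; exact: leq_addr.
have [n Sn] := Sk (Num.truncn `|M / delta|).+1; exists n; apply: lt_le_trans Sn.
by rewrite mulrC -ltr_pdivrMr// (le_lt_trans (ler_norm _))// truncnS_gt.
Qed.

End jump_process.

(** * The law of the history on the event that no stop has been decided *)

Section live_law.
Context {R : realType} {dE : measure_display} {E : measurableType dE}.
Local Notation Hist := (@hist R dE E).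
Context (Q : R -> set E -> E -> R) (T : R) (x : E).
Context (dp : forall n, R -> Hist n -> bool) (s : R).
Hypothesis hQ : semi_markov_kernel Q.
Hypothesis T0 : 0 <= T.
Hypothesis mdp : forall n, measurable_fun setT (fun p : R * Hist n => dp p.1 p.2).

(** An equivalence would fail for the uncontrolled process, whose action is always
    [false]. *)
Definition follows {dO} {Omega : measurableType dO} (P : probability Omega R)
    (X : nat -> Omega -> ehat E) (A : nat -> Omega -> bool) (Tt : nat -> Omega -> R) :=
  {ae P, forall w n, stop_at dp s (Yhat X A Tt n w) = false -> A n w = false}.

(** The conditional mass of the next step as a function of the history: the indicator retains only
    histories at which the policy continues, and there the action is [false]. *)
Definition live_kernel n (B : set (Hist n)) (t : R) (C : set (ehat E)) (h : Hist n) : \bar R :=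
  (Qhat Q T t C (hist_state h n) false *
    \1_(B `&` [set h | stop_at dp s h = false]) h)%:E.

Let mgo n : measurable [set h : Hist n | stop_at dp s h = false].
Proof.
have := measurable_stop_at s mdp measurableT (Y := [set false]) Logic.I.
by move=> /(_ n); rewrite setTI.
Qed.

Lemma measurable_live_kernel n B t C : 0 <= t -> measurable B -> measurable C ->
  measurable_fun setT (@live_kernel n B t C).
Proof.
move=> t0 mB mC; apply/measurable_EFinP; apply: measurable_funM.
  exact: (measurableT_comp (measurable_Qhat T hQ t0 mC) (@measurable_hist_state _ _ _ n n)).
by apply: measurable_indic; apply: measurableI => //; exact: mgo.
Qed.

Lemma live_kernel_ge0 n B t C h : 0 <= t -> measurable C -> (0 <= @live_kernel n B t C h)%E.
Proof. by move=> t0 mC; rewrite lee_fin mulr_ge0// (Qhat_ge0 T hQ). Qed.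

Section one_process.
Context {dO} {Omega : measurableType dO} (P : probability Omega R)
  (X : nat -> Omega -> ehat E) (A : nat -> Omega -> bool) (Tt : nat -> Omega -> R).
Hypothesis law : jump_law Q T x P X A Tt.
Hypothesis pol : follows P X A Tt.
Local Notation Y := (Yhat X A Tt).
Local Notation L := (live X A Tt dp s).

Let mX n : measurable_fun setT (X n). Proof. by have [+ _ _] := law => /(_ n)[]. Qed.
Let mA n : measurable_fun setT (A n). Proof. by have [+ _ _] := law => /(_ n)[]. Qed.
Let mT n : measurable_fun setT (Tt n). Proof. by have [+ _ _] := law => /(_ n)[]. Qed.

Lemma measurable_jump_hist n : measurable_fun setT (Y n).
Proof. exact: measurable_Yhat. Qed.

Lemma measurable_jump_live n : measurable (L n).
Proof. exact: measurable_live. Qed.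

Definition next n (w : Omega) : Hist n * (R * ehat E) := (Y n w, (Tt n.+1 w, X n.+1 w)).

Lemma measurable_next n : measurable_fun setT (@next n).
Proof.
apply: measurable_fun_pair; first exact: measurable_jump_hist.
exact: measurable_fun_pair.
Qed.

Let mYB n (B : set (Hist n)) : measurable B -> measurable (Y n @^-1` B).
Proof. by move=> mB; have := @measurable_jump_hist n measurableT B mB; rewrite setTI. Qed.

(** The history of stage 0 is almost surely constant, so its law depends on [x] only. *)
Lemma live_law0 B : measurable B -> P (L 0 `&` Y 0 @^-1` B) = \d_((Some x, [tuple]) : Hist 0) B.
Proof.
move=> mB; rewrite setTI.
have aeY : {ae P, forall w, Y 0 w = (Some x, [tuple])}.
  have [_ + _] := law; apply: filterS => w [X0 _].
  by rewrite /Yhat X0; congr pair; exact: tuple0.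
rewrite diracE; have [yB|yB] := boolP (_ \in B).
  rewrite -(@probability_setT _ _ _ P); apply: ae_eq_measure => //; first exact: mYB.
  by apply: filterS aeY => w /= ->; rewrite inE in yB.
transitivity (P set0); last by rewrite measure0.
apply: ae_eq_measure => //; first exact: mYB.
by apply: filterS aeY => w /= ->; rewrite notin_setE in yB.
Qed.

(** The jump law applies because continuing through stage [n] with a history in [B] is an event of
    the past; [follows] then replaces the action by [false]. *)
Lemma live_law_rect n B t C : 0 <= t -> measurable B -> measurable C ->
  P (L n.+1 `&` @next n @^-1` (B `*` (`]-oo, t] `*` C))) =
  (\int[P]_(w in L n) live_kernel B t C (Y n w))%E.
Proof.
move=> t0 mB mC.
have sF : hist_sigma_hat X A Tt n (L n.+1 `&` Y n @^-1` B).
  apply: (@measurableI _ (g_sigma_algebraType (hist_gens X A Tt n))).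
    by apply: (@measurable_live _ _ _ _ (g_sigma_algebraType (hist_gens X A Tt n))) => //;
      [exact: sigmaX|exact: sigmaA|exact: sigmaT].
  have := @measurable_Yhat _ _ _ _ (g_sigma_algebraType (hist_gens X A Tt n)) X A Tt n
    (@sigmaX _ _ _ _ _ X A Tt n) (@sigmaA _ _ _ _ _ X A Tt n) (@sigmaT _ _ _ _ _ X A Tt n)
    measurableT B mB.
  by rewrite setTI.
have [_ _ /(_ n _ sF t t0 C mC)] := law.
rewrite (_ : _ `&` _ = L n.+1 `&` @next n @^-1` (B `*` (`]-oo, t] `*` C))); last first.
  by apply/seteqP; split => w /=; rewrite in_itv/=; tauto.
move=> ->; rewrite integral_mkcond [RHS]integral_mkcond.
apply: ge0_ae_eq_integral_nonmeasurable.
- by move=> w; apply: erestrict_ge0 => y _; rewrite lee_fin (Qhat_ge0 T hQ).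
- by move=> w; apply: erestrict_ge0 => y _; exact: live_kernel_ge0.
- apply/(measurable_restrictT _ (measurable_jump_live n)).
  apply: measurable_funTS.
  exact: (measurableT_comp (measurable_live_kernel t0 mB mC) (@measurable_jump_hist n)).
apply: filterS pol => w /(_ n) Aw; rewrite !patchE /live_kernel indicE.
rewrite hist_state_Yhat//.
have [wL|wL] := boolP (w \in L n); last first.
  rewrite memNset// => -[[Lw _] _]; by rewrite mem_set in wL.
case: ifPn.
  by rewrite inE => -[[_ /= st] BY]; rewrite mem_set// mulr1 Aw.
rewrite notin_setE => nw; rewrite memNset ?mulr0// => -[BY st]; apply: nw.
by split => //; split => //; rewrite inE in wL.
Qed.

(** Complements the jump law, stated for [t >= 0]: sojourn times are almost surely positive. *)
Lemma live_law_neg n B t C : t < 0 -> measurable B -> measurable C ->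
  P (L n.+1 `&` @next n @^-1` (B `*` (`]-oo, t] `*` C))) = 0%E.
Proof.
move=> t0 mB mC; transitivity (P set0); last by rewrite measure0.
apply: ae_eq_measure => //.
  apply: measurableI; first exact: measurable_jump_live.
  rewrite -[_ @^-1` _]setTI; apply: measurable_next => //.
  by apply: measurableX => //; apply: measurableX => //; exact: measurable_itv.
apply: filterS (ae_time_gt0 hQ T0 law) => w /(_ n) wT; split => // -[_ [_ []]] /=.
by rewrite in_itv/= => wt; have := le_lt_trans wt t0; rewrite ltNge ltW.
Qed.

Lemma live_lawS n D : measurable D ->
  P (L n.+1 `&` Y n.+1 @^-1` D) =
  P (L n.+1 `&` @next n @^-1` (@hist_rcons _ _ _ n @^-1` D)).
Proof.
move=> mD; apply: ae_eq_measure.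
- by apply: measurableI; [exact: measurable_jump_live|exact: mYB].
- apply: measurableI; first exact: measurable_jump_live.
  have mr := measurableT_comp (@measurable_hist_rcons _ _ _ n) (@measurable_next n).
  by have := mr measurableT D mD; rewrite setTI.
apply: filterS pol => w /(_ n) Aw.
have Yn : L n.+1 w -> Y n.+1 w = hist_rcons (next n w).
  by move=> -[_ /= st]; rewrite hist_rcons_Yhat// Aw.
by split => -[Lw /=]; [rewrite Yn|rewrite -Yn].
Qed.

End one_process.

(** Induction on [n]: equal laws at stage [n] give equal integrals of [live_kernel], hence equal
    masses of rectangles, hence equal laws of the history paired with the next step; [hist_rcons]
    carries these to stage [n.+1]. *)
Lemma live_law_unique {dO} {Omega : measurableType dO} (P : probability Omega R)
    (X : nat -> Omega -> ehat E) (A : nat -> Omega -> bool) (Tt : nat -> Omega -> R)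
    {dO'} {Omega' : measurableType dO'} (P' : probability Omega' R)
    (X' : nat -> Omega' -> ehat E) (A' : nat -> Omega' -> bool) (Tt' : nat -> Omega' -> R) :
  jump_law Q T x P X A Tt -> follows P X A Tt ->
  jump_law Q T x P' X' A' Tt' -> follows P' X' A' Tt' ->
  forall n B, measurable B ->
  P (live X A Tt dp s n `&` Yhat X A Tt n @^-1` B) =
  P' (live X' A' Tt' dp s n `&` Yhat X' A' Tt' n @^-1` B).
Proof.
move=> law pol law' pol'; elim => [|n IH] B mB.
  by rewrite (live_law0 law)// (live_law0 law').
rewrite (live_lawS law pol)// (live_lawS law' pol')//.
have mL := measurable_jump_live law n.+1; have mL' := measurable_jump_live law' n.+1.
have mN := measurable_next law (n := n); have mN' := measurable_next law' (n := n).
pose m := [the {measure set _ -> \bar R} of pushforward (mrestr P mL) (next X A Tt n)].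
pose m' := [the {measure set _ -> \bar R} of
  pushforward (mrestr P' mL') (next X' A' Tt' n)].
have mE D : P (live X A Tt dp s n.+1 `&` next X A Tt n @^-1` D) = m mN D by rewrite setIC.
have mE' D : P' (live X' A' Tt' dp s n.+1 `&` next X' A' Tt' n @^-1` D) = m' mN' D.
  by rewrite setIC.
rewrite mE mE'; apply: finite_measure_rect_unique => [|C t C' mC mC'|]; last 1 first.
- by have := @measurable_hist_rcons _ _ _ n measurableT B mB; rewrite setTI.
- by rewrite -mE preimage_setT setIT; exact: (le_lt_trans (probability_le1 P mL) (ltry 1)).
rewrite -mE -mE'; have [t0|t0] := leP 0 t; last first.
  by rewrite (live_law_neg law)// (live_law_neg law').
rewrite (live_law_rect law)// (live_law_rect law')//.
(* The induction hypothesis is the equality of laws required by the transport. *)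
apply: eq_integral_transport => //.
- exact: (measurable_jump_live law).
- exact: (measurable_jump_live law').
- exact: (measurable_jump_hist law).
- exact: (measurable_jump_hist law').
- exact: measurable_live_kernel.
- by move=> h; exact: live_kernel_ge0.
Qed.

End live_law.

(** * Integrals of step functions along increasing unbounded epochs *)

Section step_functions.
Context {R : realType}.

Lemma nneseries_truncate (f : nat -> \bar R) N :
  (forall n, 0 <= f n)%E -> (forall n, (N <= n)%N -> f n = 0%E) ->
  (\sum_(n <oo) f n = \sum_(0 <= n < N) f n)%E.
Proof.
move=> f0 fN; rewrite (nneseries_split 0 N)// add0n.
by rewrite [X in (_ + X)%E]eseries0 ?adde0// => i /fN.
Qed.

Lemma nneseries_single (f : nat -> \bar R) k :
  (0 <= f k)%E -> (forall n, n != k -> f n = 0%E) -> (\sum_(n <oo) f n = f k)%E.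
Proof.
move=> fk0 fk; rewrite (nneseries_truncate (N := k.+1)).
- rewrite big_nat_recr//= big_nat big1 ?add0e// => i /andP[_ ik].
  by rewrite fk// ltn_eqF.
- by move=> n; have [->//|/fk->] := eqVneq n k.
- by move=> n kn; rewrite fk// gtn_eqF.
Qed.

Section epochs.
Variable S : nat -> R.
Hypothesis S0 : S 0 = 0.
Hypothesis S_lt : forall n, S n < S n.+1.
Hypothesis S_unbounded : forall M, exists n, M < S n.

Lemma epoch_le m n : (m <= n)%N -> S m <= S n.
Proof. by move=> mn; apply: (homo_leq lexx le_trans (fun n => ltW (S_lt n))). Qed.

Lemma epoch_ge0 n : 0 <= S n.
Proof. by rewrite -S0; exact: epoch_le. Qed.

Lemma epoch_exists t : 0 <= t -> exists n, S n <= t < S n.+1.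
Proof.
move=> t0; have [m mP mmin] := ex_minnP (S_unbounded t).
case: m => [|m] in mP mmin *; first by move: mP; rewrite S0 ltNge t0.
by exists m; rewrite mP andbT leNgt; apply/negP => /mmin; rewrite ltnn.
Qed.

Lemma epoch_inj t m n : S m <= t < S m.+1 -> S n <= t < S n.+1 -> m = n.
Proof.
move=> /andP[m1 m2] /andP[n1 n2]; apply/eqP; rewrite eqn_leq.
apply/andP; split; rewrite leqNgt; apply/negP => /epoch_le.
  by move=> nm; have := lt_le_trans n2 (le_trans nm m1); rewrite ltxx.
by move=> nm; have := lt_le_trans m2 (le_trans nm n1); rewrite ltxx.
Qed.

(** A closed form for the length of [[S n, S n.+1[] inside [[0, u]], visibly measurable in the
    epochs. The maximum with 0 keeps it nonnegative on arbitrary histories, whose epochs may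
    decrease. *)
Definition occupation u n := Num.max 0 (Num.min (S n.+1) u - Num.min (S n) u).

Lemma lebesgue_occupation u n : 0 <= u ->
  lebesgue_measure (`[S n, S n.+1[ `&` `[0, u] : set R) = (occupation u n)%:E.
Proof.
move=> u0; rewrite /occupation.
have [uS|Su] := ltP u (S n).
  rewrite (_ : _ `&` _ = set0).
    rewrite measure0 min_r ?subrr ?maxxx//.
    by rewrite (le_trans (ltW uS))// ltW.
  apply/seteqP; split => t //= [] /[!in_itv]/= /andP[St _] /andP[_ tu].
  by have := lt_le_trans uS (le_trans St tu); rewrite ltxx.
have [SSu|uSS] := leP (S n.+1) u.
  rewrite (_ : _ `&` _ = `[S n, S n.+1[%classic).
    rewrite lebesgue_measure_itv/= lte_fin S_lt -EFinB max_r//.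
    by rewrite subr_ge0 ltW.
  apply/seteqP; split => t /=; first by case.
  move=> /[dup] tS; rewrite !in_itv/= => /andP[St tSS]; split => //.
  by rewrite (le_trans (epoch_ge0 n))//= (le_trans (ltW tSS)).
rewrite (_ : _ `&` _ = `[S n, u]%classic).
  rewrite lebesgue_measure_itv/= lte_fin max_r ?subr_ge0//.
  have [_|uSn] := ltP (S n) u; first by rewrite -EFinB.
  by rewrite (@le_anti _ _ u (S n)) ?subrr// Su uSn.
apply/seteqP; split => t /=; rewrite !in_itv/=.
  by move=> [/andP[-> _] /andP[_ ->]].
move=> /andP[St tu]; rewrite St tu (le_lt_trans tu uSS) andbT.
by rewrite (le_trans (epoch_ge0 n)).
Qed.

(** Each time in [[0, u]] lies in exactly one interval, so [f] is there a series of weighted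
    indicators, integrated term by term. *)
Lemma integral_step_function (f : R -> R) (v : nat -> R) u :
  (forall n, 0 <= v n) -> (forall n t, S n <= t < S n.+1 -> f t = v n) -> 0 <= u ->
  (\int[lebesgue_measure]_(t in `[0%R, u]) (f t)%:E =
   \sum_(n <oo) (v n * occupation u n)%:E)%E.
Proof.
move=> v0 fv u0.
transitivity (\int[lebesgue_measure]_(t in `[0%R, u])
    \sum_(n <oo) (v n * \1_(`[S n, S n.+1[%classic) t)%:E)%E.
  apply: eq_integral => t; rewrite inE/= in_itv/= => /andP[t0 _].
  have [k kt] := epoch_exists t0; rewrite (nneseries_single (k := k)).
  - by rewrite indicE mem_set/= ?in_itv//= mulr1 (fv k).
  - by rewrite lee_fin mulr_ge0.
  - move=> n nk; rewrite indicE memNset ?mulr0//= in_itv/= => nt.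
    by move: nk; rewrite (epoch_inj nt kt) eqxx.
rewrite integral_nneseries//; last 2 first.
- move=> n; apply: measurable_funTS; apply/measurable_EFinP.
  by apply: measurable_funM => //; exact: measurable_indic.
- by move=> n t _; rewrite lee_fin mulr_ge0.
apply: eq_eseriesr => n _; under eq_integral do rewrite EFinM.
rewrite ge0_integralZl_EFin//; last first.
- by apply: measurable_funTS; apply/measurable_EFinP; exact: measurable_indic.
rewrite integral_indic// EFinM; congr (_ * _)%E; exact: lebesgue_occupation.
Qed.

(** The index that [step_proc] obtains by choice is unique, the intervals being disjoint. *)
Lemma step_proc_eq (Omega Y : Type) (y0 : Y) (Z : nat -> Omega -> Y)
    (SS : nat -> Omega -> R) w n t :
  SS^~ w = S -> S n <= t < S n.+1 -> step_proc y0 Z SS w t = Z n w.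
Proof.
move=> SE nt; have SSE k : SS k w = S k by rewrite -SE.
rewrite /step_proc; case: pselect => [H|[]]; last by exists n; rewrite !SSE.
by case: (cid H) => m /=; rewrite !SSE => mt; rewrite (epoch_inj mt nt).
Qed.

End epochs.
End step_functions.

(** * The total gain as a series of functions of histories *)

Section total_gain.
Context {R : realType} {dE : measure_display} {E : measurableType dE}.
Local Notation Hist := (@hist R dE E).
Context (c g : E -> R) (dp : forall n, R -> Hist n -> bool) (s : R).
Hypothesis mc : measurable_fun setT c.
Hypothesis mg : measurable_fun setT g.
Hypothesis c0 : forall y, 0 <= c y.
Hypothesis g0 : forall y, 0 <= g y.

Lemma chat_ge0 y a : 0 <= chat c y a.
Proof. by case: y a => [y|] [] //=; exact: c0. Qed.

Lemma ghat_ge0 y a : 0 <= ghat g y a.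
Proof. by case: y a => [y|] [] //=; exact: g0. Qed.

Lemma occupation_ge0 (S : nat -> R) u n : 0 <= occupation S u n.
Proof. by rewrite le_max lexx. Qed.

(** The history of stage [n.+1] is used because the time spent in stage [n] depends on the next
    epoch. *)
Definition running_gain n (h : Hist n.+1) : \bar R :=
  (chat c (hist_state h n) false * occupation (hist_epoch h) s n)%:E.

(** The inequality is strict as in [reward], which pays no [g] when the stop falls at [s]. *)
Definition stopping_gain n (h : Hist n) : \bar R :=
  (ghat g (hist_state h n) true * (stop_at dp s h && (hist_epoch h n < s))%:R)%:E.

Lemma running_gain_ge0 n h : (0 <= @running_gain n h)%E.
Proof. by rewrite lee_fin mulr_ge0 ?chat_ge0 ?occupation_ge0. Qed.

Lemma stopping_gain_ge0 n h : (0 <= @stopping_gain n h)%E.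
Proof. by rewrite lee_fin mulr_ge0 ?ghat_ge0. Qed.

Lemma measurable_running_gain n : measurable_fun setT (@running_gain n).
Proof.
apply/measurable_EFinP; apply: measurable_funM.
  have mch : measurable_fun setT (fun y : ehat E => chat c y false).
    exact: measurable_fun_ehat.
  exact: (measurableT_comp mch (@measurable_hist_state _ _ _ n.+1 n)).
apply: measurable_maxr => //; apply: measurable_funB;
  by apply: measurable_minr => //; exact: measurable_hist_epoch.
Qed.

Hypothesis mdp : forall n, measurable_fun setT (fun p : R * Hist n => dp p.1 p.2).

Lemma measurable_stopping_gain n : measurable_fun setT (@stopping_gain n).
Proof.
apply/measurable_EFinP; apply: measurable_funM.
  have mgh : measurable_fun setT (fun y : ehat E => ghat g y true).
    exact: measurable_fun_ehat.
  exact: (measurableT_comp mgh (@measurable_hist_state _ _ _ n n)).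
have mb : measurable_fun setT (fun h : Hist n => stop_at dp s h && (hist_epoch h n < s)).
  apply: measurable_and; first exact: measurable_stop_at.
  by apply: measurable_fun_ltr => //; exact: measurable_hist_epoch.
have mbR : measurable_fun setT (fun b : bool => b%:R : R) by [].
exact: (measurableT_comp mbR mb).
Qed.

Section process.
Context {Omega : Type} (X : nat -> Omega -> ehat E) (A : nat -> Omega -> bool)
  (Tt : nat -> Omega -> R).
Local Notation L := (live X A Tt dp s).
Local Notation Y := (Yhat X A Tt).

Definition gain n (w : Omega) : \bar R :=
  (((@running_gain n \o Y n.+1) \_ (L n.+1)) w + ((@stopping_gain n \o Y n) \_ (L n)) w)%E.

Definition total_gain (w : Omega) : \bar R := (\sum_(n <oo) gain n w)%E.

Lemma gain_ge0 n w : (0 <= gain n w)%E.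
Proof.
apply: adde_ge0; apply: erestrict_ge0 => y _ /=.
  exact: running_gain_ge0.
exact: stopping_gain_ge0.
Qed.

Lemma total_gain_ge0 w : (0 <= total_gain w)%E.
Proof. by apply: nneseries_ge0 => n _ _; exact: gain_ge0. Qed.

Lemma stop_at_Yhat n w : Tt 0 w = 0 ->
  stop_at dp s (Y n w) = dp (s - Ssum Tt n w) (Y n w).
Proof. by move=> T0; rewrite /stop_at hist_epoch_Yhat. Qed.

Lemma running_gain_Yhat n w : Tt 0 w = 0 -> running_gain (Y n.+1 w) =
  (chat c (X n w) false * occupation (Ssum Tt ^~ w) s n)%:E.
Proof.
by move=> T0; rewrite /running_gain hist_state_Yhat// /occupation !hist_epoch_Yhat.
Qed.

Lemma gain_live n w : Tt 0 w = 0 -> L n.+1 w ->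
  gain n w = (chat c (X n w) false * occupation (Ssum Tt ^~ w) s n)%:E.
Proof.
move=> T0 Lw; rewrite /gain !patchE !mem_set//=; last by case: Lw.
rewrite running_gain_Yhat// /stopping_gain; case: Lw => _ /= ->.
by rewrite mulr0 adde0.
Qed.

(** Stages before [N] contribute their running gain only, stage [N] its terminal gain only, and
    later stages nothing since they are no longer live. *)
Lemma total_gain_stopped N w : Tt 0 w = 0 ->
  (forall i, (i < N)%N -> stop_at dp s (Y i w) = false) ->
  stop_at dp s (Y N w) = true ->
  total_gain w =
  (\sum_(0 <= n < N) (chat c (X n w) false * occupation (Ssum Tt ^~ w) s n)%:E
   + (ghat g (X N w) true * (Ssum Tt N w < s)%R%:R)%:E)%E.
Proof.
move=> T0 goN stN.
have Lle n : (n <= N)%N -> L n w.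
  by move=> nN; apply/liveP => i /leq_trans/(_ nN)/goN.
have Lgt n : (N < n)%N -> ~ L n w by move=> Nn /liveP/(_ N Nn); rewrite stN.
rewrite /total_gain (nneseries_truncate (N := N.+1)); first last.
- move=> n Nn; rewrite /gain !patchE !memNset ?adde0//; apply: Lgt => //.
  by rewrite ltnS ltnW.
- by move=> n; exact: gain_ge0.
rewrite big_nat_recr//=; congr (_ + _)%E.
  by apply: eq_big_nat => n /andP[_ nN]; rewrite gain_live//; exact: Lle.
rewrite /gain !patchE memNset; last exact: Lgt.
rewrite mem_set; last exact: Lle.
by rewrite add0e /= /stopping_gain stN hist_state_Yhat// hist_epoch_Yhat.
Qed.

Lemma total_gain_unstopped w : Tt 0 w = 0 ->
  (forall i, stop_at dp s (Y i w) = false) ->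
  total_gain w =
  (\sum_(n <oo) (chat c (X n w) false * occupation (Ssum Tt ^~ w) s n)%:E)%E.
Proof.
by move=> T0 go; apply: eq_eseriesr => n _; rewrite gain_live//; apply/liveP.
Qed.

End process.

Section law.
Context (Q : R -> set E -> E -> R) (T : R) (x : E).
Context {dO} {Omega : measurableType dO} (P : probability Omega R)
  (X : nat -> Omega -> ehat E) (A : nat -> Omega -> bool) (Tt : nat -> Omega -> R).
Hypothesis law : jump_law Q T x P X A Tt.

Let m1 n : measurable_fun setT
  ((@running_gain n \o Yhat X A Tt n.+1) \_ (live X A Tt dp s n.+1)).
Proof.
apply/(measurable_restrictT _ (measurable_jump_live s mdp law _)).
apply: measurable_funTS.
exact: (measurableT_comp (@measurable_running_gain n) (measurable_jump_hist law (n := n.+1))).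
Qed.

Let m2 n : measurable_fun setT
  ((@stopping_gain n \o Yhat X A Tt n) \_ (live X A Tt dp s n)).
Proof.
apply/(measurable_restrictT _ (measurable_jump_live s mdp law _)).
apply: measurable_funTS.
exact: (measurableT_comp (@measurable_stopping_gain n) (measurable_jump_hist law (n := n))).
Qed.

Lemma measurable_gain n : measurable_fun setT (gain X A Tt n).
Proof. exact: emeasurable_funD. Qed.

Lemma measurable_total_gain : measurable_fun setT (total_gain X A Tt).
Proof.
apply: ge0_emeasurable_sum => [n w _ _|n _]; first exact: gain_ge0.
exact: measurable_gain.
Qed.

(** Each term becomes the integral of a function of the history over a live event, as the transport
    requires. *)
Lemma integral_total_gain :
  (\int[P]_w total_gain X A Tt w = \sum_(n <oo)
    (\int[P]_(w in live X A Tt dp s n.+1) running_gain (Yhat X A Tt n.+1 w) +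
     \int[P]_(w in live X A Tt dp s n) stopping_gain (Yhat X A Tt n w)))%E.
Proof.
rewrite integral_nneseries//; last 2 first.
- exact: measurable_gain.
- by move=> n w _; exact: gain_ge0.
apply: eq_eseriesr => n _; rewrite ge0_integralD//; last 2 first.
- by move=> w _; apply: erestrict_ge0 => y _; exact: running_gain_ge0.
- by move=> w _; apply: erestrict_ge0 => y _; exact: stopping_gain_ge0.
by rewrite -!integral_mkcond.
Qed.

End law.

Lemma integral_total_gain_unique (Q : R -> set E -> E -> R) (T : R) (x : E)
    {dO} {Omega : measurableType dO} (P : probability Omega R)
    (X : nat -> Omega -> ehat E) (A : nat -> Omega -> bool) (Tt : nat -> Omega -> R)
    {dO'} {Omega' : measurableType dO'} (P' : probability Omega' R)
    (X' : nat -> Omega' -> ehat E) (A' : nat -> Omega' -> bool) (Tt' : nat -> Omega' -> R) :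
  semi_markov_kernel Q -> 0 <= T ->
  jump_law Q T x P X A Tt -> follows dp s P X A Tt ->
  jump_law Q T x P' X' A' Tt' -> follows dp s P' X' A' Tt' ->
  (\int[P]_w total_gain X A Tt w = \int[P']_w total_gain X' A' Tt' w)%E.
Proof.
move=> hQ T0 law pol law' pol'.
rewrite (integral_total_gain law) (integral_total_gain law').
apply: eq_eseriesr => n _; congr (_ + _)%E.
  apply: eq_integral_transport.
  - exact: (measurable_jump_live s mdp law).
  - exact: (measurable_jump_live s mdp law').
  - exact: (measurable_jump_hist law).
  - exact: (measurable_jump_hist law').
  - exact: measurable_running_gain.
  - exact: running_gain_ge0.
  - exact: (live_law_unique hQ T0 mdp law pol law' pol').
apply: eq_integral_transport.
- exact: (measurable_jump_live s mdp law).
- exact: (measurable_jump_live s mdp law').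
- exact: (measurable_jump_hist law).
- exact: (measurable_jump_hist law').
- exact: measurable_stopping_gain.
- exact: stopping_gain_ge0.
- exact: (live_law_unique hQ T0 mdp law pol law' pol').
Qed.

End total_gain.

(** * Pathwise identification of both payoffs with the total gain *)

Lemma Ssum0 {R : realType} {Omega : Type} (Tt : nat -> Omega -> R) w :
  Tt 0 w = 0 -> Ssum Tt 0 w = 0.
Proof. by rewrite /Ssum big_nat1. Qed.

Lemma SsumS {R : realType} {Omega : Type} (Tt : nat -> Omega -> R) n w :
  Ssum Tt n.+1 w = Ssum Tt n w + Tt n.+1 w.
Proof. by rewrite /Ssum big_nat_recr. Qed.

Section rewards.
Context {R : realType} {dE : measure_display} {E : measurableType dE}.
Local Notation Hist := (@hist R dE E).
Context (c g : E -> R) (dp : forall n, R -> Hist n -> bool) (s : R).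
Hypothesis c0 : forall y, 0 <= c y.
Hypothesis g0 : forall y, 0 <= g y.
Hypothesis s0 : 0 <= s.

Lemma occupation_before (S : nat -> R) u n : (forall n, S n < S n.+1) ->
  S n.+1 <= u -> occupation S u n = S n.+1 - S n.
Proof.
move=> S_lt Su; rewrite /occupation !min_l// ?(le_trans (ltW (S_lt n)))//.
by rewrite max_r// subr_ge0 ltW.
Qed.

Lemma occupation_after (S : nat -> R) u n : (forall n, S n < S n.+1) ->
  u <= S n -> occupation S u n = 0.
Proof.
by move=> S_lt Su; rewrite /occupation !min_r ?subrr ?maxxx// (le_trans Su)// ltW.
Qed.

Section path.
Context {Omega : Type} (Tt : nat -> Omega -> R) (w : Omega).
Hypothesis T0 : Tt 0 w = 0.
Hypothesis T_gt0 : forall n, 0 < Tt n.+1 w.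
Hypothesis S_unbounded : forall M, exists n, M < Ssum Tt n w.

Let S0 : Ssum Tt 0 w = 0. Proof. exact: Ssum0. Qed.
Let S_lt n : Ssum Tt n w < Ssum Tt n.+1 w. Proof. by rewrite SsumS ltrDl T_gt0. Qed.

Lemma lim_Ssum : limn (fun n => (Ssum Tt n w)%:E) = +oo%E.
Proof.
apply/cvg_lim => //; apply/cvgeyPge => M; have [n Mn] := S_unbounded M.
exists n => // m /= nm; rewrite lee_fin (le_trans (ltW Mn))//.
exact: (epoch_le S_lt).
Qed.

(** With the constant action [false], [Yhat] is [Y0], so [stop_at] is the very test that defines the
    induced stopping time. *)
Lemma reward_total_gain (X : nat -> Omega -> E) :
  reward c g X Tt (induced_stop dp s X Tt) s w =
  total_gain c g dp s (fun n w => Some (X n w)) (fun _ _ => false) Tt w.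
Proof.
have stE n : stop_at dp s (Yhat (fun n w => Some (X n w)) (fun _ _ => false) Tt n w) =
    dp (s - Ssum Tt n w) (Y0 X Tt n w) by exact: stop_at_Yhat.
have XtE n t : Ssum Tt n w <= t < Ssum Tt n.+1 w ->
    step_proc point X (Ssum Tt) w t = X n w by exact: (step_proc_eq S_lt).
have intE u : 0 <= u -> (\int[lebesgue_measure]_(t in `[0%R, u])
    (c (step_proc point X (Ssum Tt) w t))%:E =
    \sum_(n <oo) (c (X n w) * occupation (Ssum Tt ^~ w) u n)%:E)%E.
  move=> u0; apply: (integral_step_function S0 S_lt S_unbounded) => //.
  by move=> n t /XtE ->.
have term0 u n : (0 <= (c (X n w) * occupation (Ssum Tt ^~ w) u n)%:E)%E.
  by rewrite lee_fin mulr_ge0// occupation_ge0.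
rewrite /reward /S_stop /induced_stop; case: pselect => [H|noH]; last first.
  (* Without a stop, [S_tau] is infinite and the reward is the integral up to [s]. *)
  rewrite lim_Ssum /= intE// total_gain_unstopped// => n.
  by rewrite stE; apply/negbTE/negP => st; apply: noH; exists n.
case: ex_minnP => N stN minN; rewrite lte_fin /=.
rewrite (total_gain_stopped c0 g0 (N := N)) ?stE//; last first.
  by move=> i iN; rewrite stE; apply/negbTE/negP => /minN; rewrite leqNgt iN.
case: ifPn => [SNs|]; last first.
  (* Stages from [N] on begin after [s] and occupy none of [[0, s]]. *)
  rewrite -leNgt => sSN; rewrite intE//.
  rewrite mulr0 adde0 (nneseries_truncate (N := N))// => n Nn.
  by rewrite occupation_after ?mulr0// (le_trans sSN)//; exact: (epoch_le S_lt).
rewrite intE; last exact: (epoch_ge0 S0 S_lt).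
rewrite (nneseries_truncate (N := N))//; last first.
  by move=> n Nn; rewrite occupation_after ?mulr0//; exact: (epoch_le S_lt).
congr (_ + _)%E; last by rewrite mulr1 (XtE N)// lexx S_lt.
(* Stages before [N] end by [S_N < s], so the horizons [S_N] and [s] give them the same
   occupation. *)
apply: eq_big_nat => n /andP[_ nN] /=.
have SnN : Ssum Tt n.+1 w <= Ssum Tt N w by exact: (epoch_le S_lt).
by rewrite !occupation_before// (le_trans SnN)// ltW.
Qed.

(** If [N] is the first stopping stage, its sojourn extends beyond [s]; so the stage in force at [s]
    is [N] or an earlier one, according to whether [S_N] precedes [s]. *)
Lemma payoff_total_gain (T : R) (x : E) (X : nat -> Omega -> ehat E)
    (A : nat -> Omega -> bool) :
  s <= T -> (forall n (h : Hist n), hist0 h -> dp 0 h = false) ->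
  X 0 w = Some x ->
  (forall n, A n w = dp (s - Ssum Tt n w) (Yhat X A Tt n w)) ->
  (forall n, A n w = true -> T < Tt n.+1 w) ->
  (forall n, A n w = false -> X n.+1 w <> Delta) ->
  (\int[lebesgue_measure]_(t in `[0%R, s])
     (chat c (step_proc Delta X (Ssum Tt) w t) (step_proc true A (Ssum Tt) w t))%:E
   + (ghat g (step_proc Delta X (Ssum Tt) w s) (step_proc true A (Ssum Tt) w s))%:E)%E =
  total_gain c g dp s X A Tt w.
Proof.
move=> sT dp0 X0 AE TA XA.
have stE n : stop_at dp s (Yhat X A Tt n w) = A n w by rewrite stop_at_Yhat// AE.
have [k ks] := epoch_exists S0 S_unbounded s0.
rewrite (step_proc_eq S_lt _ _ _ ks)// (step_proc_eq S_lt _ _ _ ks)//.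
rewrite (integral_step_function (v := fun n => chat c (X n w) (A n w)) S0 S_lt S_unbounded)//;
  first last.
- by move=> n t nt; rewrite !(step_proc_eq S_lt _ _ _ nt).
- by move=> n; exact: chat_ge0.
have [[N0 AN0]|noA] := pselect (exists n, A n w); last first.
  have Af n : A n w = false by apply/negbTE/negP => An; apply: noA; exists n.
  rewrite total_gain_unstopped//; last by move=> n; rewrite stE.
  rewrite Af (_ : ghat g (X k w) false = 0) ?adde0; last by case: (X k w).
  by apply: eq_eseriesr => n _; rewrite Af.
have [N AN minN] := ex_minnP (ex_intro (fun n => A n w) N0 AN0).
have Af i : (i < N)%N -> A i w = false.
  by move=> iN; apply/negbTE/negP => /minN; rewrite leqNgt iN.
have sSN : s < Ssum Tt N.+1 w.
  rewrite SsumS (le_lt_trans sT)// (lt_le_trans (TA N AN))// lerDr.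
  exact: (epoch_ge0 S0 S_lt).
rewrite (total_gain_stopped c0 g0 (N := N)) ?stE//; last first.
  by move=> i /Af; rewrite stE.
congr (_ + _)%E.
  rewrite (nneseries_truncate (N := N)).
  - by apply: eq_big_nat => n /andP[_ /Af ->].
  - by move=> n; rewrite lee_fin mulr_ge0 ?chat_ge0 ?occupation_ge0.
  (* Stage [N] earns no running gain because its action is [true]; later stages begin after [s]. *)
  - move=> n; rewrite leq_eqVlt => /predU1P[<-|Nn].
      by rewrite AN (_ : chat c _ true = 0) ?mul0r//; case: (X N w).
    by rewrite occupation_after ?mulr0// (le_trans (ltW sSN))//; exact: (epoch_le S_lt).
(* A stop at [S_N = s] would be decided with remaining time 0 on a history of continuing actions and
   states in [E], where the policy prescribes [false]. *)
have SNs : Ssum Tt N w != s.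
  apply/eqP => SNs; move: AN; rewrite AE SNs subrr dp0//; split; first by rewrite /= X0.
  move=> m; rewrite tnth_mktuple /=; split; [exact: Af|exact: ltW|].
  by apply: XA; exact: Af.
have [SNs'|sSN'] := ltP (Ssum Tt N w) s.
  rewrite mulr1; have -> : k = N; last by rewrite AN.
  by apply: (epoch_inj S_lt ks); rewrite ltW.
have kN : (k < N)%N.
  rewrite ltnNge; apply/negP => /(epoch_le S_lt) Nk; move/eqP: SNs; apply.
  by apply/le_anti; rewrite sSN' andbT (le_trans Nk)//; case/andP: ks.
by rewrite Af// mulr0; case: (X k w).
Qed.

End path.
End rewards.

(** * Reduction of both values to the expected total gain *)

(** A constant action adds only trivial events to the past, and under the action [false] the kernel
    [Qhat] reduces to [Q] on traces in [E]. *)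
Lemma smp_jump_law (R : realType) (dE : measure_display) (E : measurableType dE)
    (Q : R -> set E -> E -> R) (T : R) (x : E) dO (Omega : measurableType dO)
    (P : probability Omega R) (X : nat -> Omega -> E) (Tt : nat -> Omega -> R) :
  smp_law Q x P X Tt ->
  jump_law Q T x P (fun n w => Some (X n w)) (fun _ _ => false) Tt.
Proof.
move=> [mX mT ini law]; split.
- by move=> n; split => //; exact: (measurableT_comp (@measurable_Some _ E) (mX n)).
- by apply: filterS ini => w [-> ->].
move=> n F sF t t0 B mB.
rewrite [X in P (_ `&` (_ `&` X))](_ : _ = X n.+1 @^-1` (@Some E @^-1` B))// law//.
move: F sF; apply: smallest_sub; first exact: smallest_sigma_algebra.
move=> _ [k [kn [[C [mC ->]]|[C [mC ->]]|[C ->]]]].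
- apply: sub_sigma_algebra; exists k; split => //; left.
  by exists (@Some E @^-1` C).
- by apply: sub_sigma_algebra; exists k; split => //; right; exists C.
- have [Cf|Cf] := pselect (C false).
    rewrite (_ : _ @^-1` C = setT); last by apply/seteqP; split.
    exact: (@measurableT _ (g_sigma_algebraType _)).
  rewrite (_ : _ @^-1` C = set0); last by apply/seteqP; split.
  exact: (@measurable0 _ (g_sigma_algebraType _)).
Qed.

Theorem theorem4p1 (R : realType) (dE : measure_display) (E : measurableType dE)
  (Q : R -> set E -> E -> R) (c g : E -> R) (T : R) :
  @borel_space R dE E ->
  semi_markov_kernel Q ->
  (exists delta eps : R, [/\ 0 < delta, 0 < eps &
     forall x : E, Q delta setT x <= 1 - eps]) ->
  measurable_fun setT c -> measurable_fun setT g ->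
  (forall x, 0 <= c x) -> (forall x, 0 <= g x) ->
  0 <= T ->
  forall dp : forall n, R -> @hist R dE E n -> bool,
  Pi0DH dp ->
  forall (x : E) (s : R), 0 <= s <= T ->
  forall (dO : measure_display) (Omega : measurableType dO)
         (P : probability Omega R) (X : nat -> Omega -> E) (Tt : nat -> Omega -> R),
  smp_law Q x P X Tt ->
  forall (dO' : measure_display) (Omega' : measurableType dO')
         (P' : probability Omega' R) (Xh : nat -> Omega' -> ehat E)
         (Ah : nat -> Omega' -> bool) (Th : nat -> Omega' -> R),
  smdp_law Q T dp s x P' Xh Ah Th ->
  U_value c g P' Xh Ah Th s = V_value c g P X Tt (induced_stop dp s X Tt) s.
Proof.
move=> _ hQ contr mc mg c0 g0 T0 dp [[mdp _] dp0] x s /andP[s0 sT].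
move=> dO Omega P X Tt smp dO' Omega' P' Xh Ah Th smdp.
have law := smp_jump_law T smp.
have pol : follows dp s P (fun n w => Some (X n w)) (fun _ _ => false) Tt.
  by apply: aeW => w n _.
have [mXAT ini AE lawh] := smdp.
have law' : jump_law Q T x P' Xh Ah Th by split.
have pol' : follows dp s P' Xh Ah Th.
  apply: filterS2 ini AE => w [_ T0w] Aw n; rewrite stop_at_Yhat// => st.
  by rewrite Aw.
transitivity (\int[P']_w total_gain c g dp s Xh Ah Th w)%E.
  apply: ge0_ae_eq_integral_nonmeasurable.
  - move=> w; apply: adde_ge0; last by rewrite lee_fin; exact: ghat_ge0.
    by apply: integral_ge0 => t _; rewrite lee_fin; exact: chat_ge0.
  - by move=> w; exact: total_gain_ge0.
  - exact: (measurable_total_gain _ mc mg c0 g0 mdp law').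
  (* The exceptional null sets are gathered, so that the pathwise identity holds off their union. *)
  apply: filterS3 (ae_time_gt0 hQ T0 law') (ae_epoch_unbounded hQ T0 law' contr)
    (filterI (filterI ini AE)
      (filterI (ae_stop_time_gt T0 law') (ae_continue_state hQ law'))).
  move=> w Tgt Sun [[[X0 T0w] Aw] [AT AX]].
  exact: (payoff_total_gain c0 g0 s0 T0w Tgt Sun sT dp0 X0 Aw AT AX).
rewrite (integral_total_gain_unique mc mg c0 g0 mdp hQ T0 law' pol' law pol).
apply/esym; apply: ge0_ae_eq_integral_nonmeasurable.
- move=> w; rewrite /reward; case: ifP => _.
    apply: adde_ge0; last by rewrite lee_fin.
    by apply: integral_ge0 => t _; rewrite lee_fin.
  by apply: integral_ge0 => t _; rewrite lee_fin.
- by move=> w; exact: total_gain_ge0.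
- exact: (measurable_total_gain _ mc mg c0 g0 mdp law).
have [_ ini' _] := law.
apply: filterS3 ini' (ae_time_gt0 hQ T0 law) (ae_epoch_unbounded hQ T0 law contr).
by move=> w [_ T0w] Tgt Sun; exact: reward_total_gain.
Qed.
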